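(* Let $f,g\in H$. Then either the subgroup $\langle f,g\rangle$ generated by $f$ and $g$ is metabelian, or it contains a free abelian subgroup of rank two.
   Context: Let $\mathbb{P}^1=\mathbb{P}^1(\mathbb{R})$ with its usual topology (a circle) and the natural action of $\mathrm{PSL}_2(\mathbb{R})$. Let $G$ be the group of homeomorphisms of $\mathbb{P}^1$ which are piecewise in $\mathrm{PSL}_2(\mathbb{R})$ with finitely many pieces, each an interval of $\mathbb{P}^1$. Let $\infty\in\mathbb{P}^1$ be the point corresponding to the first basis vector of $\mathbb{R}^2$ and $H<G$ the stabilizer of $\infty$. *)

(* Defs.v *)
From Stdlib Require Import Reals List.
Open Scope R_scope.

(* P^1(R) = R ∪ {∞}; the point [a:b] (b <> 0) is Some (a/b); None = ∞ = [1:0]. *)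
Definition P1 : Type := option R.
Definition infty : P1 := None.

Definition openR (U : R -> Prop) : Prop :=
  forall x, U x -> exists eps, 0 < eps /\ forall y, Rabs (y - x) < eps -> U y.

(* chart around ∞ : t |-> [-1 : t] *)
Definition chart_infty (t : R) : P1 :=
  if Req_EM_T t 0 then None else Some (- / t).

Definition openP1 (U : P1 -> Prop) : Prop :=
  openR (fun x => U (Some x)) /\ openR (fun t => U (chart_infty t)).

Definition continuousP1 (f : P1 -> P1) : Prop :=
  forall U, openP1 U -> openP1 (fun p => U (f p)).

Definition is_homeoP1 (f : P1 -> P1) : Prop :=
  exists f' : P1 -> P1,
    (forall p, f' (f p) = p) /\ (forall p, f (f' p) = p) /\
    continuousP1 f /\ continuousP1 f'.

(* action of the matrix [[a,b],[c,d]] : [x:y] |-> [ax+by : cx+dy] *)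
Definition mob (a b c d : R) (p : P1) : P1 :=
  match p with
  | None => if Req_EM_T c 0 then None else Some (a / c)
  | Some x => if Req_EM_T (c * x + d) 0 then None
              else Some ((a * x + b) / (c * x + d))
  end.

Definition in_PSL2_action (h : P1 -> P1) (dom : P1 -> Prop) : Prop :=
  exists a b c d, a * d - b * c = 1 /\ forall p, dom p -> h p = mob a b c d p.

Definition ltP (p q : P1) : Prop :=
  match p, q with
  | Some x, Some y => x < y
  | Some _, None => True
  | None, _ => False
  end.

(* x lies in the open arc going (positively) from a to b, for a <> b *)
Definition cyc_between (a x b : P1) : Prop :=
  (ltP a x /\ ltP x b) \/ (ltP x b /\ ltP b a) \/ (ltP b a /\ ltP a x).

Definition same_component (S : list P1) (x y : P1) : Prop :=
  ~ In x S /\ ~ In y S /\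
  (x = y \/ (forall s, In s S -> ~ cyc_between x s y)
         \/ (forall s, In s S -> ~ cyc_between y s x)).

Definition in_G (f : P1 -> P1) : Prop :=
  is_homeoP1 f /\
  exists S : list P1, forall x, ~ In x S ->
    in_PSL2_action f (same_component S x).

Definition in_H (f : P1 -> P1) : Prop := in_G f /\ f infty = infty.

Definition comp (u v : P1 -> P1) : P1 -> P1 := fun p => u (v p).

Inductive gen (A : (P1 -> P1) -> Prop) : (P1 -> P1) -> Prop :=
  | gen_base : forall u, A u -> gen A u
  | gen_id : gen A (fun p => p)
  | gen_comp : forall u v, gen A u -> gen A v -> gen A (comp u v)
  | gen_inv : forall u u', gen A u ->
      (forall p, u' (u p) = p) -> (forall p, u (u' p) = p) -> gen A u'
  | gen_ext : forall u v, gen A u -> (forall p, u p = v p) -> gen A v.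

Definition commutators (Gam : (P1 -> P1) -> Prop) (w : P1 -> P1) : Prop :=
  exists u u' v v', Gam u /\ Gam v /\
    (forall p, u' (u p) = p) /\ (forall p, u (u' p) = p) /\
    (forall p, v' (v p) = p) /\ (forall p, v (v' p) = p) /\
    forall p, w p = u' (v' (u (v p))).

Definition derived (Gam : (P1 -> P1) -> Prop) := gen (commutators Gam).

Definition abelian (Gam : (P1 -> P1) -> Prop) : Prop :=
  forall u v, Gam u -> Gam v -> forall p, u (v p) = v (u p).

Definition metabelian (Gam : (P1 -> P1) -> Prop) : Prop :=
  abelian (derived Gam).

(* Gam contains a free abelian subgroup of rank two: two commuting elements
   u, v with u^m v^n (m, n in Z) all distinct; for commuting u, v this is
   equivalent to u^m1 v^n1 = u^m2 v^n2 -> (m1,n1) = (m2,n2) over naturals. *)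
Definition contains_Z2 (Gam : (P1 -> P1) -> Prop) : Prop :=
  exists u v, Gam u /\ Gam v /\ (forall p, u (v p) = v (u p)) /\
    forall m1 n1 m2 n2 : nat,
      (forall p, Nat.iter m1 u (Nat.iter n1 v p) = Nat.iter m2 u (Nat.iter n2 v p)) ->
      m1 = m2 /\ n1 = n2.

Definition gen2 (f g : P1 -> P1) := gen (fun u => u = f \/ u = g).

(* Main.v *)
Require Import Defs.
From Stdlib Require Import Reals List.
From Stdlib Require Import Lra Lia Classical FunctionalExtensionality.

(* This is the argument of Brin and Squier. Both maps act on the line by
   increasing homeomorphisms. At each end of a component of the complement of
   the common fixed set, the germs of the group are projective maps fixing that
   end, hence affine in a suitable coordinate; so commutators of the group act
   there as translations, and a commutator of two elements of the derived group
   is trivial near every end. If the group is not metabelian, some such element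
   is nontrivial; its support in each of the finitely many components is bounded
   away from the ends, and the group contains an element displacing that support
   in a chosen component. Commuting with the resulting conjugate either gives a
   nontrivial element living on fewer components, or the two commute and
   generate a free abelian group of rank two. *)

(** * Components of the complement of a subset of the line *)

(** A partial equivalence relation, reflexive exactly off [A]; its classes are the pieces into which
    [A] cuts the line, so no separate hypothesis that the points avoid [A] has to be carried. *)
Definition same_side (A : R -> Prop) (x y : R) : Prop :=
  forall t, A t -> (t < x /\ t < y) \/ (x < t /\ y < t).

Lemma same_side_sym A x y : same_side A x y -> same_side A y x.
Proof. intros H t Ht. destruct (H t Ht); lra. Qed.

Lemma same_side_trans A x y z :
  same_side A x y -> same_side A y z -> same_side A x z.
Proof.
  intros H K t Ht. destruct (H t Ht); destruct (K t Ht); lra.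
Qed.

Lemma same_side_sub (A B : R -> Prop) x y :
  (forall t, B t -> A t) -> same_side A x y -> same_side B x y.
Proof. intros H K t Ht. exact (K t (H t Ht)). Qed.

Lemma same_side_notl A x y : same_side A x y -> ~ A x.
Proof. intros H K. destruct (H x K); lra. Qed.

Lemma same_side_between A x y z :
  same_side A x y -> x <= z <= y \/ y <= z <= x -> same_side A x z.
Proof. intros H K t Ht. destruct (H t Ht); lra. Qed.

Lemma choice_list (Q : R -> R -> Prop) (P : list R) :
  exists P', forall p, In p P -> (exists y, Q p y) ->
    exists y, In y P' /\ Q p y.
Proof.
  induction P as [|q P [P' IH]].
  - exists nil. intros p [].
  - destruct (classic (exists y, Q q y)) as [[y Hy]|Hn].
    + exists (y :: P'). intros p [<-|Hp] Hex.
      * exists y. split; [left; reflexivity | exact Hy].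
      * destruct (IH p Hp Hex) as [z [Hz Hq]]. exists z. split; [right|]; assumption.
    + exists P'. intros p [<-|Hp] Hex; [contradiction | auto].
Qed.

(** Induction on [T]: for every old representative, a point of its piece on each side of the new
    point [s] is kept whenever one exists. [choice_list] makes these finitely many choices. *)
Lemma finite_sample (T : list R) :
  exists P, forall x, ~ In x T ->
    exists p, In p P /\ same_side (fun t => In t T) x p.
Proof.
  induction T as [|s T [P IH]].
  - exists (0 :: nil). intros x _. exists 0. split; [left; reflexivity|].
    intros t [].
  - destruct (choice_list
      (fun p y => same_side (fun t => In t T) p y /\ y < s) P) as [P1 H1].
    destruct (choice_list
      (fun p y => same_side (fun t => In t T) p y /\ s < y) P) as [P2 H2].
    exists (P1 ++ P2). intros x Hx.
    assert (HxT : ~ In x T) by (intro; apply Hx; right; assumption).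
    assert (Hxs : x <> s) by (intro; apply Hx; left; congruence).
    destruct (IH x HxT) as [p [Hp Hxp]].
    destruct (Rtotal_order x s) as [L|[L|L]]; [|contradiction|].
    + destruct (H1 p Hp) as [y [Hy [Hpy Hys]]].
      { exists x. split; [apply same_side_sym; assumption | assumption]. }
      exists y. split; [apply in_or_app; auto|].
      intros t [<-|Ht]; [right; lra|].
      exact (same_side_trans _ _ _ _ Hxp Hpy t Ht).
    + destruct (H2 p Hp) as [y [Hy [Hpy Hys]]].
      { exists x. split; [apply same_side_sym; assumption | lra]. }
      exists y. split; [apply in_or_app; auto|].
      intros t [<-|Ht]; [left; lra|].
      exact (same_side_trans _ _ _ _ Hxp Hpy t Ht).
Qed.

(** * Germs at the ends of intervals *)

(* An end [e] approached in the direction [sg = 1] (increasing) or [sg = -1]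
   (decreasing); [None] stands for the infinite end in that direction. *)
Definition sign (sg : R) : Prop := sg = 1 \/ sg = -1.

Definition before (sg : R) (e : option R) (y : R) : Prop :=
  match e with Some x => sg * y < sg * x | None => True end.

(** One-sided punctured neighbourhoods of the end. Requiring [m] to lie strictly before [e] makes
    them nonempty. *)
Definition near (sg : R) (e : option R) (U : R -> Prop) : Prop :=
  exists m, before sg e m /\
    forall y, sg * m < sg * y -> before sg e y -> U y.

(** An infinite end counts as fixed because only increasing bijections of the line are
    considered. *)
Definition fixes (u : R -> R) (e : option R) : Prop :=
  match e with Some x => u x = x | None => True end.

Definition increasing_map (u : R -> R) : Prop := forall x y, x < y -> u x < u y.

Definition inverse_maps (u u' : R -> R) : Prop :=
  (forall x, u' (u x) = x) /\ (forall x, u (u' x) = x).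

Lemma near_mono sg e (U V : R -> Prop) :
  near sg e U -> (forall y, before sg e y -> U y -> V y) -> near sg e V.
Proof.
  intros [m [Hm HU]] H. exists m. split; [assumption|]. intros y H1 H2. auto.
Qed.

Lemma near_and sg e U V :
  near sg e U -> near sg e V -> near sg e (fun y => U y /\ V y).
Proof.
  intros [m [Hm HU]] [n [Hn HV]].
  destruct (Rle_dec (sg * m) (sg * n)).
  - exists n. split; [assumption|]. intros y H1 H2.
    split; [apply HU | apply HV]; auto; lra.
  - exists m. split; [assumption|]. intros y H1 H2.
    split; [apply HU | apply HV]; auto; lra.
Qed.

Lemma near_point sg e U : sign sg -> near sg e U -> exists y, U y /\ before sg e y.
Proof.
  intros Hs [m [Hm HU]]. destruct e as [x|]; simpl in *.
  - exists ((m + x) / 2). split; [apply HU|]; destruct Hs; subst; lra.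
  - exists (m + sg). split; [apply HU|]; auto. destruct Hs; subst; lra.
Qed.

Lemma increasing_inj u x y : increasing_map u -> u x = u y -> x = y.
Proof.
  intros H K. destruct (Rtotal_order x y) as [L|[L|L]]; auto; apply H in L; lra.
Qed.

Lemma increasing_sign u sg x y :
  increasing_map u -> sign sg -> sg * x < sg * y -> sg * u x < sg * u y.
Proof.
  intros H [-> | ->] K.
  - assert (x < y) as L by lra. apply H in L. lra.
  - assert (y < x) as L by lra. apply H in L. lra.
Qed.

Lemma increasing_le u x y : increasing_map u -> x <= y -> u x <= u y.
Proof. intros H [L|L]; [apply H in L; lra | subst; lra]. Qed.

Lemma inverse_increasing u u' :
  increasing_map u -> inverse_maps u u' -> increasing_map u'.
Proof.
  intros H [H1 H2] x y L.
  destruct (Rlt_le_dec (u' x) (u' y)) as [K|K]; auto.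
  apply (increasing_le u) in K; auto. rewrite !H2 in K. lra.
Qed.

Lemma inverse_maps_sym u u' : inverse_maps u u' -> inverse_maps u' u.
Proof. intros [H K]; split; auto. Qed.

Lemma inverse_fixes u u' e : inverse_maps u u' -> fixes u e -> fixes u' e.
Proof. intros [H K]; destruct e as [x|]; simpl; auto. intros E. rewrite <- E at 1. auto. Qed.

Lemma before_image sg e u y :
  sign sg -> increasing_map u -> fixes u e -> before sg e y -> before sg e (u y).
Proof.
  intros Hs Hu He. destruct e as [x|]; simpl in *; auto.
  intros L. apply (increasing_sign u) in L; auto. rewrite He in L. assumption.
Qed.

(** An increasing bijection fixing the end permutes its one-sided neighbourhoods; the threshold [m]
    pulls back to [u' m]. *)
Lemma near_preimage sg e u u' U :
  sign sg -> increasing_map u -> inverse_maps u u' -> fixes u e ->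
  near sg e U -> near sg e (fun y => U (u y)).
Proof.
  intros Hs Hu Hi He [m [Hm HU]].
  exists (u' m). split.
  - apply before_image; auto.
    + eapply inverse_increasing; eauto.
    + eapply inverse_fixes; eauto.
  - intros y H1 H2. apply HU.
    + apply (increasing_sign u) in H1; auto. destruct Hi as [_ Hi].
      rewrite Hi in H1. assumption.
    + apply before_image; auto.
Qed.

Lemma near_avoids_finite sg e (T : list R) :
  sign sg -> near sg e (fun y => ~ In y T).
Proof.
  intros Hs. induction T as [|s T IH].
  - destruct e as [x|].
    + exists (x - sg). split; [simpl; destruct Hs; subst; lra|]. simpl; auto.
    + exists 0. simpl; auto.
  - apply (near_mono sg e (fun y => ~ In y T /\ y <> s)).
    + apply near_and; auto.
      destruct (classic (before sg e s)) as [B|B].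
      * exists s. split; auto. intros y L _ E. subst. lra.
      * destruct IH as [m [Hm _]]. exists m. split; auto.
        intros y _ H E. subst. contradiction.
    + simpl. intros y _ [H1 H2] [H|H]; auto.
Qed.

Lemma near_same_side sg e (T : list R) :
  sign sg -> exists x, ~ In x T /\ near sg e (same_side (fun t => In t T) x).
Proof.
  intros Hs. pose proof (near_avoids_finite sg e T Hs) as Hn.
  destruct Hn as [m [Hm HT]].
  assert (exists x, sg * m < sg * x /\ before sg e x) as [x [Hx1 Hx2]].
  { destruct (near_point sg e (fun y => sg * m < sg * y) Hs) as [x Hx].
    - exists m; split; auto.
    - eauto. }
  exists x. split; [auto|].
  exists m. split; auto. intros y Hy1 Hy2 t Ht.
  destruct (Rlt_le_dec (sg * m) (sg * t)) as [L|L].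
  - assert (~ before sg e t) as B by (intro; exact (HT t L H Ht)).
    destruct e as [z|]; simpl in *; [|tauto].
    destruct Hs; subst; lra.
  - destruct Hs; subst; lra.
Qed.

(** * Groups of increasing maps of the line *)

Record increasing_group (G : (R -> R) -> Prop) : Prop := {
  ig_incr : forall u, G u -> increasing_map u;
  ig_id : G (fun x => x);
  ig_comp : forall u v, G u -> G v -> G (fun x => u (v x));
  ig_inv : forall u, G u -> exists u', G u' /\ inverse_maps u u' }.

Definition common_fixed (G : (R -> R) -> Prop) (x : R) : Prop :=
  forall u, G u -> u x = x.

(** An increasing map fixing [t] preserves both sides of [t], so the group leaves every component of
    the complement of its fixed set invariant. *)
Lemma same_side_orbit G u x y :
  increasing_group G -> G u ->
  same_side (common_fixed G) x y -> same_side (common_fixed G) x (u y).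
Proof.
  intros HG Hu H t Ht. pose proof (Ht u Hu) as E.
  destruct (H t Ht) as [[H1 H2]|[H1 H2]];
    apply (ig_incr G HG u Hu) in H2; [left|right]; lra.
Qed.

(* The supremum of a bounded orbit is a common fixed point. *)
Lemma displacement G c d :
  increasing_group G -> c <= d -> same_side (common_fixed G) c d ->
  exists u, G u /\ d < u c.
Proof.
  intros HG Hcd Hs. apply NNPP. intro Hno.
  assert (Hub : forall u, G u -> u c <= d).
  { intros u Hu. destruct (Rle_dec (u c) d); auto. exfalso. apply Hno.
    exists u. split; auto. lra. }
  destruct (completeness (fun t => exists u, G u /\ t = u c)) as [s [Hs1 Hs2]].
  - exists d. intros t [u [Hu ->]]. auto.
  - exists c. exists (fun x => x). split; auto. apply HG.
  - assert (c <= s) by (apply Hs1; exists (fun x => x); split; [apply HG|reflexivity]).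
    assert (s <= d) by (apply Hs2; intros t [u [Hu ->]]; auto).
    assert (Hfix : ~ common_fixed G s).
    { intro K. destruct (Hs s K); lra. }
    (* If [u] pushed [s] up, its inverse would push [s] down, some orbit point [v c] would lie above
       [u' s], and [u (v c)] would exceed the supremum. Applied to inverses as well, this gives
       equality. *)
    assert (Hup : forall u, G u -> u s <= s).
    { intros u Hu. destruct (ig_inv G HG u Hu) as [u' [Hu' [I1 I2]]].
      destruct (Rle_dec (u s) s) as [L|L]; auto. exfalso.
      assert (u' s < s) as L'.
      { rewrite <- (I1 s) at 2. apply (ig_incr G HG u' Hu'). lra. }
      assert (s <= u' s); [|lra].
      apply Hs2. intros t [v [Hv ->]].
      destruct (Rle_dec (v c) (u' s)) as [M|M]; auto. exfalso.
      assert (u (u' s) < u (v c)) as M' by (apply (ig_incr G HG u Hu); lra).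
      rewrite I2 in M'.
      assert (u (v c) <= s); [|lra].
      apply Hs1. exists (fun x => u (v x)). split; auto. apply HG; auto. }
    apply Hfix. intros u Hu.
    destruct (ig_inv G HG u Hu) as [u' [Hu' [I1 I2]]].
    pose proof (Hup u Hu). pose proof (Hup u' Hu') as K.
    apply (increasing_le u) in K; [|apply HG; auto]. rewrite I2 in K. lra.
Qed.

(** The ends are the two infinite ones and both sides of every common fixed point. *)
Definition trivial_at_ends (G : (R -> R) -> Prop) (h : R -> R) : Prop :=
  G h /\ forall sg e, sign sg -> (forall u, G u -> fixes u e) ->
    near sg e (fun y => h y = y).

(** In direction [sg] the component of [x0] ends at the nearest common fixed point, or at infinity
    if there is none, and [h] is trivial near that end. The factor [sg] lets one argument serve both
    directions. *)
Lemma support_bound G h x0 sg :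
  increasing_group G -> trivial_at_ends G h -> sign sg ->
  ~ common_fixed G x0 ->
  exists d, sg * x0 <= sg * d /\ same_side (common_fixed G) x0 d /\
    forall y, same_side (common_fixed G) x0 y -> sg * d < sg * y -> h y = y.
Proof.
  intros HG [Gh Hh] Hs Hx.
  destruct (classic (exists s, common_fixed G s /\ sg * x0 < sg * s))
    as [[s0 [Fs0 Ls0]]|Hno].
  - destruct (completeness
      (fun t => exists s, common_fixed G s /\ sg * x0 < sg * s /\ t = - (sg * s)))
      as [m' [M1 M2]].
    { exists (- (sg * x0)). intros t [s [_ [L ->]]]. lra. }
    { eauto. }
    set (e := - (sg * m')).
    assert (Ee : sg * e = - m') by (unfold e; destruct Hs; subst; lra).
    assert (Hlow : forall s, common_fixed G s -> sg * x0 < sg * s -> sg * e <= sg * s).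
    { intros s Fs Ls. assert (- (sg * s) <= m') by (apply M1; eauto). lra. }
    assert (Hx0e : sg * x0 <= sg * e).
    { assert (m' <= - (sg * x0)); [|lra]. apply M2. intros t [s [_ [L ->]]]. lra. }
    (* The infimum is a common fixed point by monotonicity alone: [u e] is again a lower bound, and
       the inverse gives the other inequality. *)
    assert (Hdown : forall u, G u -> sg * u e <= sg * e).
    { intros u Hu. destruct (Rle_dec (sg * u e) (sg * e)) as [L|L]; auto.
      exfalso. assert (m' <= - (sg * u e)); [|lra].
      apply M2. intros t [s [Fs [Ls ->]]].
      pose proof (Hlow s Fs Ls) as K.
      assert (sg * u e <= sg * u s) as K'.
      { destruct K as [K|K].
        - apply (increasing_sign u) in K; auto; [lra|]. apply HG; auto.
        - assert (e = s) as -> by (destruct Hs; subst; lra). lra. }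
      rewrite (Fs u Hu) in K'. lra. }
    assert (Fe : common_fixed G e).
    { intros u Hu. destruct (ig_inv G HG u Hu) as [u' [Hu' [I1 I2]]].
      pose proof (Hdown u Hu) as K1. pose proof (Hdown u' Hu') as K2.
      destruct K2 as [K2|K2].
      - apply (increasing_sign u) in K2; auto; [|apply HG; auto].
        rewrite I2 in K2. lra.
      - assert (u' e = e) as E by (destruct Hs; subst; lra).
        rewrite <- E at 1. auto. }
    assert (Hx0e' : sg * x0 < sg * e).
    { destruct Hx0e as [L|L]; auto. exfalso. apply Hx.
      assert (x0 = e) as -> by (destruct Hs; subst; lra). auto. }
    destruct (Hh sg (Some e) Hs) as [m [Hm Hmh]].
    { intros u Hu. simpl. auto. }
    simpl in Hm.
    assert (exists d, sg * x0 <= sg * d /\ sg * m <= sg * d /\ sg * d < sg * e)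
      as [d [D1 [D2 D3]]].
    { destruct (Rle_dec (sg * x0) (sg * m)); [exists m | exists x0]; lra. }
    exists d. split; [auto|]. split.
    + intros t Ft.
      assert (t <> x0) by congruence.
      destruct (Rlt_le_dec (sg * x0) (sg * t)) as [L|L].
      * pose proof (Hlow t Ft L). destruct Hs; subst; lra.
      * destruct Hs; subst; lra.
    + intros y Sy Ly. apply Hmh; [lra|]. simpl.
      destruct (Sy e Fe); destruct Hs; subst; lra.
  - destruct (Hh sg None Hs) as [m [_ Hmh]].
    { intros u Hu. exact I. }
    assert (exists d, sg * x0 <= sg * d /\ sg * m <= sg * d) as [d [D1 D2]].
    { destruct (Rle_dec (sg * x0) (sg * m)); [exists m | exists x0]; lra. }
    exists d. split; [auto|]. split.
    + intros t Ft.
      assert (t <> x0) by congruence.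
      assert (~ sg * x0 < sg * t) by (intro; apply Hno; eauto).
      destruct Hs; subst; lra.
    + intros y _ Ly. apply Hmh; [lra|]. exact I.
Qed.

Lemma iter_monotone u sg x :
  increasing_map u -> sign sg -> sg * x < sg * u x ->
  forall n k, sg * Nat.iter n u x < sg * Nat.iter (n + S k) u x.
Proof.
  intros Hu Hs Hx.
  assert (Hstep : forall n, sg * Nat.iter n u x < sg * Nat.iter (S n) u x).
  { induction n; simpl in *; auto. apply increasing_sign; auto. }
  intros n k. induction k.
  - rewrite Nat.add_1_r. apply Hstep.
  - replace (n + S (S k))%nat with (S (n + S k)) by lia.
    pose proof (Hstep (n + S k)%nat). lra.
Qed.

(** An increasing map that moves [x] keeps moving it strictly in the same direction. *)
Lemma iter_injective u x m n :
  increasing_map u -> u x <> x -> Nat.iter m u x = Nat.iter n u x -> m = n.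
Proof.
  intros Hu Hx E.
  assert (exists sg, sign sg /\ sg * x < sg * u x) as [sg [Hs L]].
  { destruct (Rtotal_order x (u x)) as [L|[L|L]]; [|congruence|].
    - exists 1. split; [left; auto | lra].
    - exists (-1). split; [right; auto | lra]. }
  destruct (Nat.lt_trichotomy m n) as [K|[K|K]]; auto; exfalso.
  - pose proof (iter_monotone u sg x Hu Hs L m (n - S m)) as C.
    replace (m + S (n - S m))%nat with n in C by lia. rewrite E in C. lra.
  - pose proof (iter_monotone u sg x Hu Hs L n (m - S n)) as C.
    replace (n + S (m - S n))%nat with m in C by lia. rewrite E in C. lra.
Qed.

Lemma iter_fixed (u : R -> R) x n : u x = x -> Nat.iter n u x = x.
Proof. intros E. induction n; simpl; congruence. Qed.

Definition independent_pair (G : (R -> R) -> Prop) : Prop :=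
  exists u v, G u /\ G v /\ (forall x, u (v x) = v (u x)) /\
    forall m1 n1 m2 n2 : nat,
      (forall x, Nat.iter m1 u (Nat.iter n1 v x) = Nat.iter m2 u (Nat.iter n2 v x)) ->
      m1 = m2 /\ n1 = n2.

Lemma trivial_at_ends_conj G h s s' :
  increasing_group G -> trivial_at_ends G h -> G s -> G s' -> inverse_maps s s' ->
  trivial_at_ends G (fun x => s (h (s' x))).
Proof.
  intros HG [Gh Hh] Gs Gs' I. split.
  - apply (ig_comp G HG s (fun x => h (s' x))); auto. apply HG; auto.
  - intros sg e Hs He.
    eapply near_mono.
    + apply (near_preimage sg e s' s (fun y => h y = y)); auto.
      * apply HG; auto.
      * apply inverse_maps_sym; auto.
    + simpl. intros y _ E. rewrite E. apply I.
Qed.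

Lemma trivial_at_ends_commutator G h h' k k' :
  increasing_group G -> trivial_at_ends G h -> trivial_at_ends G k ->
  G h' -> inverse_maps h h' -> G k' -> inverse_maps k k' ->
  trivial_at_ends G (fun x => h' (k' (h (k x)))).
Proof.
  intros HG [Gh Hh] [Gk Hk] Gh' Ih Gk' Ik. split.
  - apply (ig_comp G HG h' (fun x => k' (h (k x)))); auto.
    apply (ig_comp G HG k' (fun x => h (k x))); auto. apply HG; auto.
  - intros sg e Hs He.
    eapply near_mono; [apply near_and; [apply Hh | apply Hk]; auto; eauto|].
    intros y _ [E1 E2]. rewrite E2, E1.
    rewrite <- E2 at 1. rewrite (proj1 Ik). rewrite <- E1 at 1. apply Ih.
Qed.

(* Induction on a list of representatives of the components of the complement
   of the fixed set on which [h] may move something: commuting [h] with a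
   conjugate that displaces its support in one component kills that component
   and creates no new one. *)
Lemma independent_pair_of_trivial_at_ends G (HG : increasing_group G) (L : list R) :
  forall h, trivial_at_ends G h -> (exists x, h x <> x) ->
    (forall x, h x <> x -> exists p, In p L /\ same_side (common_fixed G) x p) ->
    independent_pair G.
Proof.
  induction L as [|p L IH]; intros h Hh [x1 Hx1] Hcov.
  { destruct (Hcov x1 Hx1) as [p [[] _]]. }
  destruct (classic (exists x0, h x0 <> x0 /\ same_side (common_fixed G) x0 p))
    as [[x0 [Hx0 Sx0]]|Hno].
  2: { apply (IH h Hh); [eauto|]. intros x Hx.
       destruct (Hcov x Hx) as [q [[<-|Hq] Sq]]; eauto.
       exfalso. apply Hno. eauto. }
  assert (Fx0 : ~ common_fixed G x0) by (eapply same_side_notl; eauto).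
  pose proof Hh as [Gh _].
  destruct (support_bound G h x0 1 HG Hh (or_introl eq_refl) Fx0)
    as [d [D1 [D2 D3]]].
  destruct (support_bound G h x0 (-1) HG Hh (or_intror eq_refl) Fx0)
    as [c [C1 [C2 C3]]].
  assert (Hsupp : forall y, same_side (common_fixed G) x0 y -> h y <> y -> c <= y <= d).
  { intros y Sy Hy. split.
    - destruct (Rle_dec c y); auto. exfalso. apply Hy. apply C3; auto. lra.
    - destruct (Rle_dec y d); auto. exfalso. apply Hy. apply D3; auto. lra. }
  (* In this component [h] moves only points of [[c, d]]. Since [s] carries [c] beyond [d], the
     conjugate [k] moves there only points beyond [d]. *)
  destruct (displacement G c d HG) as [s [Gs Hs]]; [lra| |].
  { eapply same_side_trans; [apply same_side_sym; eauto | auto]. }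
  destruct (ig_inv G HG s Gs) as [s' [Gs' Is]].
  set (k := fun x => s (h (s' x))).
  assert (Hk : trivial_at_ends G k) by (apply trivial_at_ends_conj; auto).
  pose proof Hk as [Gk _].
  assert (ksupp : forall y, same_side (common_fixed G) x0 y -> k y <> y -> d < y).
  { intros y Sy Hy.
    assert (c <= s' y) as M.
    { apply Hsupp; [apply same_side_orbit; auto|].
      intro E. apply Hy. unfold k. rewrite E. apply Is. }
    apply (increasing_le s) in M; [|apply HG; auto].
    rewrite (proj2 Is) in M. lra. }
  (* The set of points moved by [u] is invariant under [u]; hence maps with disjoint supports
     commute. *)
  assert (moved : forall u y, G u -> u y <> y -> u (u y) <> u y).
  { intros u y Gu N E. apply N. eapply increasing_inj; [apply HG; eauto|]. auto. }
  assert (disj : forall y, same_side (common_fixed G) x0 y -> k y <> y -> h y = y).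
  { intros y Sy Hy. apply NNPP. intro N.
    pose proof (ksupp y Sy Hy). pose proof (Hsupp y Sy N). lra. }
  assert (Hcomm : forall y, same_side (common_fixed G) x0 y -> h (k y) = k (h y)).
  { intros y Sy. destruct (classic (k y = y)) as [E|N].
    - rewrite E. destruct (classic (h y = y)) as [E'|N']; [congruence|].
      apply NNPP. intro N. apply (moved h y Gh N').
      apply disj; [apply same_side_orbit; auto|]. congruence.
    - rewrite (disj y Sy N). apply disj; [apply same_side_orbit; auto|].
      apply moved; auto. }
  destruct (ig_inv G HG h Gh) as [h' [Gh' Ih]].
  destruct (ig_inv G HG k Gk) as [k' [Gk' Ik]].
  destruct (classic (forall x, h (k x) = k (h x))) as [Call|Cno].
  (* The exponents are read off separately: [h] moves [x0], which [k] fixes, while [k] moves [s x0],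
     whose whole orbit under [k] is fixed by [h]. *)
  - exists h, k. repeat split; auto.
    + assert (kx0 : k x0 = x0).
      { apply NNPP. intro N. apply Hx0. apply disj; auto.
        eapply same_side_trans; [eauto | apply same_side_sym; auto]. }
      pose proof (H x0) as E. rewrite !(iter_fixed k x0) in E by auto.
      eapply iter_injective; eauto. apply HG; auto.
    + assert (Sx : same_side (common_fixed G) x0 x0).
      { eapply same_side_trans; [eauto | apply same_side_sym; auto]. }
      assert (kz : k (s x0) <> s x0).
      { unfold k. rewrite (proj1 Is). intro E. apply Hx0.
        eapply increasing_inj; [apply (ig_incr G HG s Gs)|]. auto. }
      assert (hz : forall n, h (Nat.iter n k (s x0)) = Nat.iter n k (s x0)).
      { intros n.
        assert (same_side (common_fixed G) x0 (Nat.iter n k (s x0)) /\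
                k (Nat.iter n k (s x0)) <> Nat.iter n k (s x0)) as [Q1 Q2].
        { induction n as [|n [Q1 Q2]]; simpl.
          - split; auto. apply same_side_orbit; auto.
          - split; [apply same_side_orbit; auto | apply moved; auto]. }
        auto. }
      pose proof (H (s x0)) as E. rewrite !(iter_fixed h) in E by auto.
      eapply iter_injective; eauto. apply HG; auto.
  (* Otherwise the commutator of [h] and [k] is nontrivial, yet trivial on the component of [p], so
     the induction hypothesis applies to it. *)
  - assert (Hw : forall x, h' (k' (h (k x))) = x -> h (k x) = k (h x)).
    { intros x E. rewrite <- E at 2. rewrite (proj2 Ih), (proj2 Ik). auto. }
    apply (IH (fun x => h' (k' (h (k x))))).
    + apply trivial_at_ends_commutator; auto.
    + apply not_all_ex_not in Cno. destruct Cno as [x Hx]. exists x.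
      intro E. apply Hx. auto.
    + intros x Hx.
      assert (Hx' : h (k x) <> k (h x)).
      { intro E. apply Hx. rewrite E, (proj1 Ik). apply Ih. }
      assert (Fx : ~ common_fixed G x).
      { intro F. apply Hx'. rewrite (F h Gh), (F k Gk). apply F; auto. }
      assert (Sxx : same_side (common_fixed G) x x).
      { intros t Ft. destruct (Rtotal_order t x) as [?|[->|?]]; auto; contradiction. }
      destruct (classic (exists y, same_side (common_fixed G) x y /\ h y <> y))
        as [[y [Sy Hy]]|Hnone].
      * destruct (Hcov y Hy) as [q [[<-|Hq] Sq]].
        -- exfalso. apply Hx'. apply Hcomm.
           apply (same_side_trans _ _ p); auto. apply same_side_sym.
           eapply same_side_trans; eauto.
        -- exists q. split; auto. eapply same_side_trans; eauto.
      * exfalso. apply Hx'.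
        (* Conjugation by [s] preserves components, so where [h] is trivial on a whole component [k]
           is too, and the commutator moves nothing new. *)
        assert (triv : forall y, same_side (common_fixed G) x y -> h y = y).
        { intros y Sy. apply NNPP. intro N. apply Hnone. eauto. }
        assert (kx : k x = x).
        { unfold k. rewrite triv; [apply Is | apply same_side_orbit; auto]. }
        rewrite kx, (triv x Sxx). auto.
Qed.

(** * Affine germs *)

Definition on_line (h : P1 -> P1) (u : R -> R) : Prop :=
  h None = None /\ forall x, h (Some x) = Some (u x).

(** Leibniz equality, obtained by functional extensionality, transports any property of one
    restriction to another without an extensionality proof for that property. *)
Lemma on_line_unique h u v : on_line h u -> on_line h v -> u = v.
Proof.
  intros [_ H] [_ K]. apply functional_extensionality. intro x.
  pose proof (H x). pose proof (K x). congruence.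
Qed.

Lemma on_line_comp h k (u v : R -> R) :
  on_line h u -> on_line k v -> on_line (Defs.comp h k) (fun x => u (v x)).
Proof.
  intros [H1 H2] [K1 K2]. unfold Defs.comp. split; [congruence|].
  intros x. rewrite K2. auto.
Qed.

Lemma on_line_inverse h h' u :
  on_line h u -> (forall p, h' (h p) = p) -> (forall p, h (h' p) = p) ->
  exists u', on_line h' u' /\ inverse_maps u u'.
Proof.
  intros [H1 H2] L Rr.
  assert (E : forall x, exists y, h' (Some x) = Some y).
  { intros x. destruct (h' (Some x)) as [y|] eqn:E; eauto.
    pose proof (Rr (Some x)) as K. rewrite E, H1 in K. discriminate. }
  (* The default [0] is never reached, by [E]. *)
  exists (fun x => match h' (Some x) with Some y => y | None => 0 end).
  split; split.
  - rewrite <- H1 at 1. apply L.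
  - intros x. destruct (E x) as [y ->]. auto.
  - intros x. rewrite <- H2, L. auto.
  - intros x. destruct (E x) as [y Ey]. rewrite Ey.
    pose proof (Rr (Some x)) as K. rewrite Ey, H2 in K. congruence.
Qed.

(** The induction principle for generated groups, transferred to the line; it serves both for the
    whole group with affine germs and for its derived group with translation germs. *)
Lemma gen_on_line (A : (P1 -> P1) -> Prop) (Q : (R -> R) -> Prop) :
  (forall h, A h -> exists u, on_line h u /\ Q u) ->
  Q (fun x => x) ->
  (forall u v, Q u -> Q v -> Q (fun x => u (v x))) ->
  (forall u u', Q u -> inverse_maps u u' -> Q u') ->
  forall h, gen A h -> exists u, on_line h u /\ Q u.
Proof.
  intros HA H1 HM HV h Hh.
  induction Hh as [h Hh| |h k _ [u [Lu Qu]] _ [v [Lv Qv]]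
                  |h h' _ [u [Lu Qu]] I1 I2|h k _ [u [Lu Qu]] E].
  - auto.
  - exists (fun x => x). split; [split|]; auto.
  - exists (fun x => u (v x)). split; [apply on_line_comp|]; auto.
  - destruct (on_line_inverse h h' u Lu I1 I2) as [u' [Lu' I]]. eauto.
  - exists u. split; auto. destruct Lu as [L1 L2].
    split; [rewrite <- E; auto | intros x; rewrite <- E; auto].
Qed.

Definition lines (Gam : (P1 -> P1) -> Prop) (u : R -> R) : Prop :=
  exists h, Gam h /\ on_line h u.

Lemma iter_on_line h u n x :
  on_line h u -> Nat.iter n h (Some x) = Some (Nat.iter n u x).
Proof. intros [_ H]. induction n; simpl; auto. rewrite IHn. auto. Qed.

Lemma contains_Z2_of_lines Gam : independent_pair (lines Gam) -> contains_Z2 Gam.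
Proof.
  intros [u [v [[h [Gh Lh]] [[k [Gk Lk]] [C I]]]]].
  exists h, k. split; [auto|]. split; [auto|]. split.
  - intros [x|].
    + rewrite (proj2 Lk), !(proj2 Lh), (proj2 Lk), C. auto.
    + rewrite (proj1 Lk), !(proj1 Lh), (proj1 Lk). auto.
  - intros m1 n1 m2 n2 E. apply I. intros x. specialize (E (Some x)).
    rewrite !(iter_on_line k v), !(iter_on_line h u) in E by assumption.
    congruence.
Qed.

(* A coordinate sending the end [e] to infinity, in which the projective germs
   fixing [e] are affine. *)
Definition end_coord (e : option R) (y : R) : R :=
  match e with Some x => / (y - x) | None => y end.

(* Stdlib's [/ 0 = 0] makes this hold at [y = x] as well. *)
Lemma end_coord_inj e y z : end_coord e y = end_coord e z -> y = z.
Proof.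
  destruct e as [x|]; simpl; auto. intros E.
  apply (f_equal Rinv) in E. rewrite !Rinv_inv in E. lra.
Qed.

Definition affine_germ (sg : R) (e : option R) (a b : R) (u : R -> R) : Prop :=
  near sg e (fun y => end_coord e (u y) = a * end_coord e y + b).

(** The coefficients multiply as in the affine group; since [v] fixes the end, the germ of [u] may
    be evaluated at [v y]. *)
Lemma affine_germ_comp sg e a1 b1 a2 b2 u v v' :
  sign sg -> increasing_map v -> inverse_maps v v' -> fixes v e ->
  affine_germ sg e a1 b1 u -> affine_germ sg e a2 b2 v ->
  affine_germ sg e (a1 * a2) (a1 * b2 + b1) (fun x => u (v x)).
Proof.
  intros Hs Iv Vv Fv Hu Hv.
  apply (near_preimage sg e v v') in Hu; auto.
  eapply near_mono; [apply (near_and _ _ _ _ Hu Hv)|].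
  simpl. intros y _ [E1 E2]. rewrite E1, E2. ring.
Qed.

Lemma affine_germ_inverse sg e a b u u' :
  sign sg -> increasing_map u -> inverse_maps u u' -> fixes u e -> a <> 0 ->
  affine_germ sg e a b u -> affine_germ sg e (/ a) (- (b / a)) u'.
Proof.
  intros Hs Iu Vu Fu Ha Hu.
  apply (near_preimage sg e u' u) in Hu; auto.
  - eapply near_mono; [exact Hu|]. simpl. intros y _ E.
    rewrite (proj2 Vu) in E. rewrite E. field. auto.
  - eapply inverse_increasing; eauto.
  - apply inverse_maps_sym; auto.
  - eapply inverse_fixes; eauto.
Qed.

(** The maps [u0] and [v0] stand for the generators, whose common fixed points determine the ends.
    Monotonicity, invertibility and fixing of the ends are carried along because composing and
    inverting germs uses them. *)
Definition affine_at_ends (u0 v0 u : R -> R) : Prop :=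
  increasing_map u /\ (exists u', inverse_maps u u') /\
  forall sg e, sign sg -> fixes u0 e -> fixes v0 e ->
    fixes u e /\ exists a b, a <> 0 /\ affine_germ sg e a b u.

Definition translation_at_ends (u0 v0 u : R -> R) : Prop :=
  affine_at_ends u0 v0 u /\
  forall sg e, sign sg -> fixes u0 e -> fixes v0 e ->
    exists b, affine_germ sg e 1 b u.

Lemma affine_germ_id sg e : sign sg -> affine_germ sg e 1 0 (fun x => x).
Proof.
  (* The empty list merely supplies some neighbourhood of the end. *)
  intros Hs. eapply near_mono; [apply (near_avoids_finite sg e nil Hs)|].
  intros y _ _. ring.
Qed.

Lemma affine_at_ends_id u0 v0 : affine_at_ends u0 v0 (fun x => x).
Proof.
  split; [intros x y; auto|]. split; [exists (fun x => x); split; auto|].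
  intros sg e Hs _ _. split; [destruct e; simpl; auto|].
  exists 1, 0. split; [lra|]. apply affine_germ_id; auto.
Qed.

Lemma fixes_comp u v e : fixes u e -> fixes v e -> fixes (fun x => u (v x)) e.
Proof. destruct e; simpl; congruence. Qed.

Lemma inverse_maps_comp u u' v v' :
  inverse_maps u u' -> inverse_maps v v' ->
  inverse_maps (fun x => u (v x)) (fun x => v' (u' x)).
Proof.
  intros [U1 U2] [V1 V2]. split; intros x; [rewrite U1 | rewrite V2]; auto.
Qed.

Lemma affine_at_ends_comp u0 v0 u v :
  affine_at_ends u0 v0 u -> affine_at_ends u0 v0 v ->
  affine_at_ends u0 v0 (fun x => u (v x)).
Proof.
  intros [Iu [[u' Vu] Eu]] [Iv [[v' Vv] Ev]]. split; [|split].
  - intros x y L. auto.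
  - eexists. apply inverse_maps_comp; eauto.
  - intros sg e Hs F1 F2.
    destruct (Eu sg e Hs F1 F2) as [Fu [a1 [b1 [N1 G1]]]].
    destruct (Ev sg e Hs F1 F2) as [Fv [a2 [b2 [N2 G2]]]].
    split; [apply fixes_comp; auto|].
    exists (a1 * a2), (a1 * b2 + b1).
    split; [apply Rmult_integral_contrapositive; auto|].
    eapply affine_germ_comp; eauto.
Qed.

Lemma affine_at_ends_inverse u0 v0 u u' :
  affine_at_ends u0 v0 u -> inverse_maps u u' -> affine_at_ends u0 v0 u'.
Proof.
  intros [Iu [_ Eu]] Vu. split; [|split].
  - eapply inverse_increasing; eauto.
  - exists u. apply inverse_maps_sym; auto.
  - intros sg e Hs F1 F2.
    destruct (Eu sg e Hs F1 F2) as [Fu [a [b [N G]]]].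
    split; [eapply inverse_fixes; eauto|].
    exists (/ a), (- (b / a)). split; [apply Rinv_neq_0_compat; auto|].
    eapply affine_germ_inverse; eauto.
Qed.

Lemma translation_at_ends_id u0 v0 : translation_at_ends u0 v0 (fun x => x).
Proof.
  split; [apply affine_at_ends_id|]. intros sg e Hs _ _. exists 0.
  apply affine_germ_id; auto.
Qed.

Lemma translation_at_ends_comp u0 v0 u v :
  translation_at_ends u0 v0 u -> translation_at_ends u0 v0 v ->
  translation_at_ends u0 v0 (fun x => u (v x)).
Proof.
  intros [Au Tu] [Av Tv]. split; [apply affine_at_ends_comp; auto|].
  intros sg e Hs F1 F2.
  destruct (Tu sg e Hs F1 F2) as [b1 G1]. destruct (Tv sg e Hs F1 F2) as [b2 G2].
  destruct Av as [Iv [[v' Vv] Ev]]. destruct (Ev sg e Hs F1 F2) as [Fv _].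
  exists (1 * b2 + b1). replace 1 with (1 * 1) at 1 by ring.
  eapply affine_germ_comp; eauto.
Qed.

Lemma translation_at_ends_inverse u0 v0 u u' :
  translation_at_ends u0 v0 u -> inverse_maps u u' -> translation_at_ends u0 v0 u'.
Proof.
  intros [Au Tu] Vu. split; [eapply affine_at_ends_inverse; eauto|].
  intros sg e Hs F1 F2. destruct (Tu sg e Hs F1 F2) as [b G].
  destruct Au as [Iu [_ Eu]]. destruct (Eu sg e Hs F1 F2) as [Fu _].
  pose proof (affine_germ_inverse sg e 1 b u u' Hs Iu Vu Fu R1_neq_R0 G) as K.
  rewrite Rinv_1 in K. eauto.
Qed.

(* The slope of an affine germ is multiplicative, hence [1] on commutators. *)
Lemma translation_at_ends_commutator u0 v0 u v w :
  affine_at_ends u0 v0 u -> affine_at_ends u0 v0 v -> affine_at_ends u0 v0 w ->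
  (forall x, v (u (w x)) = u (v x)) -> translation_at_ends u0 v0 w.
Proof.
  intros Au Av Aw Hw. split; [auto|]. intros sg e Hs F1 F2.
  destruct Au as [Iu [[u' Vu] Eu]]. destruct Av as [Iv [[v' Vv] Ev]].
  destruct Aw as [Iw [[w' Vw] Ew]].
  destruct (Eu sg e Hs F1 F2) as [Fu [a1 [b1 [N1 G1]]]].
  destruct (Ev sg e Hs F1 F2) as [Fv [a2 [b2 [N2 G2]]]].
  destruct (Ew sg e Hs F1 F2) as [Fw _].
  pose proof (affine_germ_comp _ _ _ _ _ _ _ _ _ Hs Iv Vv Fv G1 G2) as Guv.
  pose proof (affine_germ_comp _ _ _ _ _ _ _ _ _ Hs Iu Vu Fu G2 G1) as Gvu.
  apply (near_preimage sg e w w') in Gvu; auto.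
  (* The germs of [u v] and [v u] have the same slope [a1 * a2]. Equating the first at [y] with the
     second at [w y] leaves this translation. *)
  exists ((a1 * b2 + b1 - (a2 * b1 + b2)) / (a1 * a2)).
  eapply near_mono; [apply (near_and _ _ _ _ Guv Gvu)|].
  simpl. intros y _ [E1 E2]. rewrite Hw, E1 in E2.
  apply (Rmult_eq_reg_l (a2 * a1)); [|apply Rmult_integral_contrapositive; auto].
  apply (Rplus_eq_reg_r (a2 * b1 + b2)). rewrite <- E2. field. auto.
Qed.

(** Translations commute, so [u v] and [v u] have the same germ; comparing them at [y] and [w y],
    injectivity of the coordinate gives the claim. *)
Lemma translations_commute_near_end u0 v0 u v w sg e :
  translation_at_ends u0 v0 u -> translation_at_ends u0 v0 v ->
  affine_at_ends u0 v0 w -> (forall x, v (u (w x)) = u (v x)) ->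
  sign sg -> fixes u0 e -> fixes v0 e -> near sg e (fun y => w y = y).
Proof.
  intros [Au Tu] [Av Tv] Aw Hw Hs F1 F2.
  destruct (Tu sg e Hs F1 F2) as [b1 G1]. destruct (Tv sg e Hs F1 F2) as [b2 G2].
  destruct Au as [Iu [[u' Vu] Eu]]. destruct Av as [Iv [[v' Vv] Ev]].
  destruct Aw as [Iw [[w' Vw] Ew]].
  destruct (Eu sg e Hs F1 F2) as [Fu _].
  destruct (Ev sg e Hs F1 F2) as [Fv _].
  destruct (Ew sg e Hs F1 F2) as [Fw _].
  pose proof (affine_germ_comp _ _ _ _ _ _ _ _ _ Hs Iv Vv Fv G1 G2) as Guv.
  pose proof (affine_germ_comp _ _ _ _ _ _ _ _ _ Hs Iu Vu Fu G2 G1) as Gvu.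
  apply (near_preimage sg e w w') in Gvu; auto.
  eapply near_mono; [apply (near_and _ _ _ _ Guv Gvu)|].
  simpl. intros y _ [E1 E2]. rewrite Hw, E1 in E2.
  apply (end_coord_inj e). lra.
Qed.

Lemma gen_commutators_sub A h : gen (commutators (gen A)) h -> gen A h.
Proof.
  intros H. induction H as [h H| | | |].
  - destruct H as [u [u' [v [v' [Gu [Gv [I1 [I2 [I3 [I4 E]]]]]]]]]].
    apply gen_ext with (Defs.comp u' (Defs.comp v' (Defs.comp u v))); 
      [|intros p; rewrite E; auto].
    assert (gen A u') by exact (gen_inv _ u u' Gu I1 I2).
    assert (gen A v') by exact (gen_inv _ v v' Gv I3 I4).
    apply gen_comp; [|apply gen_comp; [|apply gen_comp]]; assumption.
  - apply gen_id.
  - apply gen_comp; auto.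
  - eapply gen_inv; eauto.
  - eapply gen_ext; eauto.
Qed.

(** * Piecewise projective maps *)

(** Division in [R] is total, so the absence of a pole on each piece is stated explicitly. *)
Definition piecewise_projective (u : R -> R) (T : list R) : Prop :=
  forall x, ~ In x T -> exists a b c d, a * d - b * c = 1 /\
    forall y, same_side (fun t => In t T) x y ->
      c * y + d <> 0 /\ u y = (a * y + b) / (c * y + d).

(** In the chart at infinity the parameter [0] lies outside the ball, and elsewhere the change of
    chart [- / s] is continuous. *)
Lemma ball_openP1 z eps :
  openP1 (fun p => exists y, p = Some y /\ Rabs (y - z) < eps).
Proof.
  split.
  - intros x [y [E L]]. injection E as <-. exists (eps - Rabs (x - z)).
    split; [lra|]. intros w Hw. exists w. split; auto.
    replace (w - z) with ((w - x) + (x - z)) by ring.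
    pose proof (Rabs_triang (w - x) (x - z)). lra.
  - intros t [y [E L]]. unfold chart_infty in E.
    destruct (Req_EM_T t 0) as [|N]; [discriminate|]. injection E as <-.
    assert (C : continuity_pt (fun s => - / s) t).
    { apply (continuity_pt_opp (fun s => / s)), (continuity_pt_inv (fun s => s)); auto.
      apply derivable_continuous_pt, derivable_pt_id. }
    destruct (C (eps - Rabs (- / t - z))) as [del [D1 D2]]; [lra|].
    assert (0 < Rabs t) by (apply Rabs_pos_lt; auto).
    (* The bound [Rabs t] keeps [s] away from [0]. *)
    exists (Rmin del (Rabs t)). split; [apply Rmin_pos; lra|].
    intros s Ls.
    assert (Rabs (s - t) < del) as Ls1 by (pose proof (Rmin_l del (Rabs t)); lra).
    assert (Rabs (s - t) < Rabs t) as Ls2 by (pose proof (Rmin_r del (Rabs t)); lra).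
    assert (s <> 0).
    { intros ->. rewrite Rminus_0_l, Rabs_Ropp in Ls2. lra. }
    exists (- / s). unfold chart_infty. destruct (Req_EM_T s 0); [contradiction|].
    split; auto.
    destruct (Req_dec s t) as [->|Nst]; auto.
    assert (Rabs (- / s - - / t) < eps - Rabs (- / t - z)) as K.
    { apply (D2 s). split; [split; [exact I | congruence] | exact Ls1]. }
    replace (- / s - z) with ((- / s - - / t) + (- / t - z)) by ring.
    pose proof (Rabs_triang (- / s - - / t) (- / t - z)). lra.
Qed.

Lemma continuousP1_on_line h u x :
  continuousP1 h -> on_line h u -> continuity_pt u x.
Proof.
  intros C [_ L] eps Heps.
  destruct (C _ (ball_openP1 (u x) eps)) as [O _].
  destruct (O x) as [del [D1 D2]].
  { exists (u x). split; [apply L|]. rewrite Rminus_diag, Rabs_R0. lra. }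
  exists del. split; [lra|]. intros y [_ Hy].
  destruct (D2 y Hy) as [w [E K]]. rewrite L in E. injection E as <-. exact K.
Qed.

(** A breakpoint at infinity may be discarded: the arc inside the line joining two finite points
    avoids infinity, so only finite breakpoints can separate them. *)
Lemma in_H_on_line h :
  in_H h -> exists u T, on_line h u /\ (exists u', inverse_maps u u') /\
    (forall x, continuity_pt u x) /\ piecewise_projective u T.
Proof.
  intros [[[h' [I1 [I2 [C1 C2]]]] [S HS]] Hinf].
  assert (E : forall x, exists y, h (Some x) = Some y).
  { intros x. destruct (h (Some x)) as [y|] eqn:E; eauto.
    pose proof (I1 (Some x)) as K. rewrite E in K.
    unfold infty in Hinf. rewrite <- Hinf, I1 in K. discriminate. }
  set (u := fun x => match h (Some x) with Some y => y | None => 0 end).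
  assert (L : on_line h u).
  { split; [exact Hinf|]. intros x. unfold u. destruct (E x) as [y ->]. auto. }
  set (T := flat_map (fun p : P1 => match p with Some s => s :: nil | None => nil end) S).
  assert (HT : forall s, In (Some s) S -> In s T).
  { intros s Hs. apply in_flat_map. exists (Some s). simpl; auto. }
  assert (HT' : forall s, In s T -> In (Some s) S).
  { intros s Hs. apply in_flat_map in Hs. destruct Hs as [[r|] [H1 H2]]; simpl in H2.
    - destruct H2 as [->|[]]. auto.
    - destruct H2. }
  exists u, T. split; [auto|]. split.
  { destruct (on_line_inverse h h' u L I1 I2) as [u' [_ V]]. eauto. }
  split; [intros z; exact (continuousP1_on_line h u z C1 L)|].
  intros x Hx. destruct (HS (Some x)) as [a [b [c [d [D P]]]]]; [auto|].
  exists a, b, c, d. split; auto. intros y Sxy.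
  assert (same_component S (Some x) (Some y)) as Q.
  { split; [auto|]. split.
    { intros K. apply HT in K. destruct (Sxy y K); lra. }
    destruct (Rtotal_order x y) as [Lt|[->|Lt]]; auto.
    - right; left. intros [s|] Hs; unfold cyc_between; simpl; [|lra].
      apply HT in Hs. destruct (Sxy s Hs); lra.
    - right; right. intros [s|] Hs; unfold cyc_between; simpl; [|lra].
      apply HT in Hs. destruct (Sxy s Hs); lra. }
  apply P in Q. rewrite (proj2 L) in Q. simpl in Q.
  destruct (Req_EM_T (c * y + d) 0); [discriminate|].
  split; congruence.
Qed.

(** With determinant one the difference of the values is [(y - x) / ((c * x + d) * (c * y + d))],
    and the denominator is positive because [c * z + d] has no zero between [x] and [y]. *)
Lemma mobius_increasing a b c d x y :
  a * d - b * c = 1 -> x < y ->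
  (forall z, x <= z <= y -> c * z + d <> 0) ->
  (a * x + b) / (c * x + d) < (a * y + b) / (c * y + d).
Proof.
  intros D L N.
  assert (Nx : c * x + d <> 0) by (apply N; lra).
  assert (Ny : c * y + d <> 0) by (apply N; lra).
  assert (Pos : 0 < (c * x + d) * (c * y + d)).
  { destruct (Rlt_le_dec 0 ((c * x + d) * (c * y + d))) as [|K]; auto. exfalso.
    assert (c <> 0) as Nc.
    { intros ->. assert (d * d <= 0) by lra. assert (d <> 0) by lra.
      pose proof (Rsqr_pos_lt d H0). unfold Rsqr in *. lra. }
    apply (N (- d / c)); [|field; auto].
    set (z := - d / c) in *.
    assert (d = - c * z) as Ed by (unfold z; field; auto).
    rewrite Ed in K.
    assert (0 < c * c) by (pose proof (Rsqr_pos_lt c Nc); unfold Rsqr in *; lra).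
    assert ((x - z) * (y - z) <= 0).
    { apply (Rmult_le_reg_l (c * c)); auto. lra. }
    split; apply Rnot_lt_le; intro; nra. }
  assert ((a * y + b) / (c * y + d) - (a * x + b) / (c * x + d)
          = (y - x) / ((c * x + d) * (c * y + d))) as E.
  { transitivity ((a * d - b * c) * (y - x) / ((c * x + d) * (c * y + d))).
    - field. auto.
    - rewrite D. field. auto. }
  assert (0 < (y - x) / ((c * x + d) * (c * y + d))) by (apply Rdiv_lt_0_compat; lra).
  lra.
Qed.

(** Exceptional points are removed one at a time; continuity at [s] glues the monotonicity on its
    two sides. *)
Lemma increasing_off_finite (T : list R) : forall u : R -> R,
  (forall x, continuity_pt u x) ->
  (forall x y, x < y -> (forall t, In t T -> ~ x <= t <= y) -> u x < u y) ->
  increasing_map u.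
Proof.
  intros u Hc. induction T as [|s T IH]; intros H.
  { intros x y L. apply H; auto. }
  apply IH. intros x y L HT.
  assert (Hcont : forall eps, 0 < eps -> exists del, 0 < del /\
            forall z, Rabs (z - s) < del -> Rabs (u z - u s) < eps).
  { intros eps Heps. destruct (Hc s eps Heps) as [del [D1 D2]].
    exists del. split; auto. intros z Hz. destruct (Req_dec z s) as [->|N].
    - rewrite Rminus_diag, Rabs_R0. lra.
    - apply (D2 z). split; [split; [exact I | congruence] | exact Hz]. }
  assert (Hleft : forall x, x < s -> (forall t, In t T -> ~ x <= t <= s) -> u x < u s).
  { intros z Lz Hz.
    assert (sub : forall z1 z2, z <= z1 -> z1 < z2 -> z2 < s -> u z1 < u z2).
    { intros z1 z2 L1 L2 L3. apply H; auto. intros t [<-|Ht]; [lra|].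
      specialize (Hz t Ht). lra. }
    (* Passing to the limit at [s] gives only a weak inequality; strictness comes from first moving
       to the midpoint. *)
    apply Rlt_le_trans with (u ((z + s) / 2)); [apply sub; lra|].
    apply Rnot_lt_le. intro K.
    destruct (Hcont (u ((z + s) / 2) - u s)) as [del [D1 D2]]; [lra|].
    (* A point strictly between the midpoint and [s], within [del] of [s]. *)
    set (w := Rmax ((z + s) / 2 + (s - z) / 4) (s - del / 2)).
    assert ((z + s) / 2 < w /\ w < s /\ s - del < w) as [W1 [W2 W3]].
    { unfold w, Rmax. destruct Rle_dec; lra. }
    assert (u ((z + s) / 2) < u w) by (apply sub; lra).
    assert (Rabs (u w - u s) < u ((z + s) / 2) - u s) as Q
      by (apply D2; apply Rabs_def1; lra).
    apply Rabs_def2 in Q. lra. }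
  assert (Hright : forall y, s < y -> (forall t, In t T -> ~ s <= t <= y) -> u s < u y).
  { intros z Lz Hz.
    assert (sub : forall z1 z2, z2 <= z -> z1 < z2 -> s < z1 -> u z1 < u z2).
    { intros z1 z2 L1 L2 L3. apply H; auto. intros t [<-|Ht]; [lra|].
      specialize (Hz t Ht). lra. }
    apply Rle_lt_trans with (u ((z + s) / 2)); [|apply sub; lra].
    apply Rnot_lt_le. intro K.
    destruct (Hcont (u s - u ((z + s) / 2))) as [del [D1 D2]]; [lra|].
    set (w := Rmin ((z + s) / 2 - (z - s) / 4) (s + del / 2)).
    assert (w < (z + s) / 2 /\ s < w /\ w < s + del) as [W1 [W2 W3]].
    { unfold w, Rmin. destruct Rle_dec; lra. }
    assert (u w < u ((z + s) / 2)) by (apply sub; lra).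
    assert (Rabs (u w - u s) < u s - u ((z + s) / 2)) as Q
      by (apply D2; apply Rabs_def1; lra).
    apply Rabs_def2 in Q. lra. }
  destruct (classic (x <= s <= y)) as [[[L1|L1] [L2|L2]]|N].
  - apply Rlt_trans with (u s); [apply Hleft | apply Hright]; auto;
      intros t Ht K; apply (HT t Ht); lra.
  - subst s. apply Hleft; auto.
  - subst s. apply Hright; auto.
  - lra.
  - apply H; auto. intros t [<-|Ht]; auto.
Qed.

Lemma piecewise_projective_increasing u T :
  (forall x, continuity_pt u x) -> piecewise_projective u T -> increasing_map u.
Proof.
  intros Hc Hp. apply (increasing_off_finite T u Hc).
  intros x y L HT.
  assert (Hs : forall z, x <= z <= y -> same_side (fun t => In t T) x z).
  { intros z Hz t Ht. specialize (HT t Ht).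
    destruct (Rlt_le_dec t x); [left; lra|].
    destruct (Rlt_le_dec y t); [right; lra|]. exfalso. apply HT. lra. }
  destruct (Hp x) as [a [b [c [d [D P]]]]].
  { intro K. apply (HT x K). lra. }
  rewrite (proj2 (P x (Hs x ltac:(lra)))), (proj2 (P y (Hs y ltac:(lra)))).
  apply mobius_increasing; auto. intros z Hz. apply P. auto.
Qed.

Lemma projective_germ u T sg e :
  sign sg -> piecewise_projective u T ->
  exists a b c d, a * d - b * c = 1 /\
    near sg e (fun y => c * y + d <> 0 /\ u y = (a * y + b) / (c * y + d)).
Proof.
  intros Hs Hp. destruct (near_same_side sg e T Hs) as [x [Hx Hn]].
  destruct (Hp x Hx) as [a [b [c [d [D P]]]]].
  exists a, b, c, d. split; auto.
  eapply near_mono; [exact Hn|]. auto.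
Qed.

Lemma continuous_zero_near sg x (G : R -> R) :
  sign sg -> continuity_pt G x -> near sg (Some x) (fun y => G y = 0) -> G x = 0.
Proof.
  intros Hs Hc Hn. apply NNPP. intro N.
  destruct (Hc (Rabs (G x))) as [del [D1 D2]]; [apply Rabs_pos_lt; auto|].
  assert (near sg (Some x) (fun y => Rabs (y - x) < del)) as Hd.
  { exists (x - sg * del). split; [destruct Hs; subst; simpl; lra|].
    intros y Y1 Y2. simpl in Y2. apply Rabs_def1; destruct Hs; subst; lra. }
  destruct (near_point sg (Some x) _ Hs (near_and _ _ _ _ Hn Hd)) as [y [[Y1 Y2] Y3]].
  simpl in Y3.
  assert (Rabs (G y - G x) < Rabs (G x)) as K.
  { apply (D2 y). split; [split; [exact I|] | exact Y2]. intros ->. lra. }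
  rewrite Y1, Rminus_0_l, Rabs_Ropp in K. lra.
Qed.

(** Were [c] nonzero, [u] would tend to the finite value [a / c] at the end, which is impossible for
    an increasing bijection. The contradiction is one of signs: beyond [m] the difference
    [u y - a / c] has the sign of [sg], but far out the formula gives the opposite sign. *)
Lemma projective_germ_at_infinity u u' sg a b c d :
  sign sg -> increasing_map u -> inverse_maps u u' -> a * d - b * c = 1 ->
  near sg None (fun y => c * y + d <> 0 /\ u y = (a * y + b) / (c * y + d)) ->
  c = 0.
Proof.
  intros Hs Iu Vu D [m [_ Hm]]. apply NNPP. intro Nc.
  assert (Hne : forall y, sg * m < sg * y -> c * (c * y + d) * (u y - a / c) = -1).
  { intros y Ly. destruct (Hm y Ly I) as [N E]. rewrite E.
    transitivity (- (a * d - b * c)); [field; auto | lra]. }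
  assert (Hpos : forall y, sg * m < sg * y -> 0 < sg * (u y - a / c)).
  { intros y Ly. apply Rnot_le_lt. intro K.
    set (z := u' (a / c)).
    assert (Ez : u z = a / c) by apply Vu.
    assert (sg * y <= sg * z) as K'.
    { apply Rnot_lt_le. intro Q. apply (increasing_sign u) in Q; auto.
      rewrite Ez in Q. lra. }
    pose proof (Hne z ltac:(lra)) as C. rewrite Ez, Rminus_diag in C. lra. }
  assert (Nc2 : 0 < c * c) by (pose proof (Rsqr_pos_lt c Nc); unfold Rsqr in *; lra).
  assert (exists y, sg * m < sg * y /\ 0 <= sg * (c * (c * y + d))) as [y [Y1 Y2]].
  { exists (sg * (Rmax (sg * m) (- sg * d / c) + 1)).
    pose proof (Rmax_l (sg * m) (- sg * d / c)) as M1.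
    pose proof (Rmax_r (sg * m) (- sg * d / c)) as M2.
    set (M := Rmax (sg * m) (- sg * d / c)) in *.
    split; [destruct Hs; subst; lra|].
    assert (c * c * (- sg * d / c) <= c * c * M) as Q by (apply Rmult_le_compat_l; lra).
    replace (c * c * (- sg * d / c)) with (- sg * d * c) in Q by (field; auto).
    destruct Hs; subst; nra. }
  pose proof (Hne y Y1) as E. pose proof (Hpos y Y1) as P.
  assert (0 <= (sg * (c * (c * y + d))) * (sg * (u y - a / c))) by
    (apply Rmult_le_pos; lra).
  destruct Hs; subst; nra.
Qed.

Lemma projective_affine_germ u u' T sg e :
  sign sg -> increasing_map u -> inverse_maps u u' -> (forall x, continuity_pt u x) ->
  piecewise_projective u T -> fixes u e ->
  exists a b, a <> 0 /\ affine_germ sg e a b u.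
Proof.
  intros Hs Iu Vu Hc Hp He.
  destruct (projective_germ u T sg e Hs Hp) as [a [b [c [d [D Hn]]]]].
  destruct e as [x|].
  - simpl in He.
    (* Continuity extends the projective formula, with denominators cleared, to the end itself. *)
    assert (E0 : u x * (c * x + d) - (a * x + b) = 0).
    { apply (continuous_zero_near sg x (fun y => u y * (c * y + d) - (a * y + b)) Hs).
      - specialize (Hc x). reg.
      - eapply near_mono; [exact Hn|]. simpl. intros y _ [N E]. rewrite E.
        field. auto. }
    rewrite He in E0.
    assert (Nx : c * x + d <> 0).
    { intro K. rewrite K in E0.
      assert (a * (c * x + d) - c * (a * x + b) = 1) by lra.
      rewrite K in H. replace (a * x + b) with 0 in H by lra. lra. }
    (* As [x] is fixed, [u y - x] equals [(y - x) / ((c * y + d) * (c * x + d))]; inverting and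
       writing [c * y + d] as [c * (y - x) + (c * x + d)] gives these coefficients. *)
    exists ((c * x + d) * (c * x + d)), (c * (c * x + d)).
    split; [apply Rmult_integral_contrapositive; auto|].
    eapply near_mono; [exact Hn|]. simpl. intros y By [N E].
    assert (y <> x) by (intros ->; lra).
    assert (Eb : b = x * (c * x + d) - a * x) by lra.
    assert (Ey : u y - x = (y - x) / ((c * y + d) * (c * x + d))).
    { rewrite E.
      transitivity ((a * d - b * c) * (y - x) / ((c * y + d) * (c * x + d)) +
        ((a * x + b) - x * (c * x + d)) / (c * x + d)).
      - field. auto.
      - rewrite D. replace (a * x + b - x * (c * x + d)) with 0 by lra.
        field. auto. }
    rewrite Ey. field. repeat split; auto. lra.
  - assert (c = 0) as ->.
    { eapply projective_germ_at_infinity; eauto. }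
    assert (Nd : d <> 0) by (intros ->; lra).
    exists (a / d), (b / d). split.
    + intro K. assert (a = 0) by (apply (Rmult_eq_reg_r (/ d));
        [rewrite Rmult_0_l; exact K | apply Rinv_neq_0_compat; auto]).
      subst. lra.
    + eapply near_mono; [exact Hn|]. simpl. intros y _ [N E]. rewrite E. field.
      lra.
Qed.

(** * Finiteness of the set of components *)

(** Degenerate coefficients are allowed: three distinct roots force all of them to vanish. *)
Lemma quadratic_roots A B C :
  exists P, forall y, A * y * y + B * y + C = 0 ->
    In y P \/ forall z, A * z * z + B * z + C = 0.
Proof.
  destruct (classic (exists r, A * r * r + B * r + C = 0)) as [[r Hr]|N].
  2: { exists nil. intros y Hy. exfalso. eauto. }
  destruct (classic (exists s, A * s * s + B * s + C = 0 /\ s <> r)) as [[s [Hs Ns]]|N].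
  2: { exists (r :: nil). intros y Hy. left. left. apply NNPP. intro.
       apply N. exists y. auto. }
  exists (r :: s :: nil). intros y Hy.
  destruct (Req_dec y r); [left; left; auto|].
  destruct (Req_dec y s); [left; right; left; auto|]. right.
  assert (E1 : A * (y + r) + B = 0) by (apply (Rmult_eq_reg_r (y - r)); lra).
  assert (E2 : A * (s + r) + B = 0) by (apply (Rmult_eq_reg_r (s - r)); lra).
  assert (A = 0) by (apply (Rmult_eq_reg_r (y - s)); lra).
  subst A. assert (B = 0) by lra. subst B. assert (C = 0) by lra. subst C.
  intros; ring.
Qed.

(** The fixed points on one piece are the roots of [c * y * y + (d - a) * y - b]: finitely many, or
    the entire piece. [T'] consists of [T] and the isolated roots found on one sample per piece. *)
Lemma fixed_points_tame u T :
  piecewise_projective u T ->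
  exists T', forall x y, same_side (fun t => In t T') x y -> u x = x -> u y = y.
Proof.
  intros Hp. destruct (finite_sample T) as [P HP].
  assert (HR : forall Q : list R, exists T', forall p, In p Q -> ~ In p T -> forall x y,
    same_side (fun t => In t T) p x -> same_side (fun t => In t T) p y ->
    ~ In x T' -> u x = x -> u y = y).
  { induction Q as [|q Q [T' IH]].
    - exists nil. intros p [].
    - destruct (classic (In q T)) as [K|K].
      + exists T'. intros p [<-|Hq]; [contradiction|]. apply IH; auto.
      + destruct (Hp q K) as [a [b [c [d [D F]]]]].
        destruct (quadratic_roots c (d - a) (- b)) as [L HL].
        exists (L ++ T'). intros p Hq Np x y Sx Sy Nx Ex.
        assert (~ In x L /\ ~ In x T') as [N1 N2]
          by (split; intro; apply Nx; apply in_or_app; auto).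
        destruct Hq as [<-|Hq]; [|exact (IH p Hq Np x y Sx Sy N2 Ex)].
        destruct (F x Sx) as [Dx Fx]. destruct (F y Sy) as [Dy Fy].
        assert (Rx : c * x * x + (d - a) * x + - b = 0).
        { rewrite Ex in Fx.
          apply (f_equal (fun z => z * (c * x + d))) in Fx.
          replace ((a * x + b) / (c * x + d) * (c * x + d)) with (a * x + b)
            in Fx by (field; auto). lra. }
        destruct (HL x Rx) as [|Hall]; [contradiction|].
        specialize (Hall y). rewrite Fy.
        apply (Rmult_eq_reg_r (c * y + d)); auto.
        replace ((a * y + b) / (c * y + d) * (c * y + d)) with (a * y + b)
          by (field; auto). lra. }
  destruct (HR P) as [T' HT'].
  exists (T ++ T'). intros x y Sxy Ex.
  assert (SxyT : same_side (fun t => In t T) x y).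
  { eapply same_side_sub; [|exact Sxy]. intros t Ht. apply in_or_app. auto. }
  pose proof (same_side_notl _ _ _ Sxy) as Nx.
  destruct (HP x (same_side_notl _ _ _ SxyT)) as [p [Hp1 Hp2]].
  apply same_side_sym in Hp2.
  apply (HT' p Hp1 (same_side_notl _ _ _ Hp2) x y); auto.
  - eapply same_side_trans; eauto.
  - intro. apply Nx. apply in_or_app. auto.
Qed.

(** A point of [F] between [x] and its sample would lie in the same piece of the complement of [T]
    as [x], forcing [F x]. Points of [T] represent themselves. *)
Lemma finitely_many_components (F : R -> Prop) (T : list R) :
  (forall x y, same_side (fun t => In t T) x y -> F x -> F y) ->
  exists L, forall x, ~ F x -> exists p, In p L /\ same_side F x p.
Proof.
  intros H. destruct (finite_sample T) as [P HP].
  exists (T ++ P). intros x Nx.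
  destruct (classic (In x T)) as [K|K].
  - exists x. split; [apply in_or_app; auto|].
    intros t Ft. destruct (Rtotal_order t x) as [|[->|]]; auto. contradiction.
  - destruct (HP x K) as [p [Hp Sp]]. exists p. split; [apply in_or_app; auto|].
    intros t Ft. apply NNPP. intro N.
    apply Nx. apply (H t x); auto. apply same_side_sym.
    apply (same_side_between _ _ p); auto. lra.
Qed.

(** * The dichotomy for two generators *)

Theorem theorem3 (f g : P1 -> P1) (hf : in_H f) (hg : in_H g) :
  metabelian (gen2 f g) \/ contains_Z2 (gen2 f g).
Proof.
  destruct (in_H_on_line f hf) as [u0 [Tf [Lf [[u0' Vf] [Cf Pf]]]]].
  destruct (in_H_on_line g hg) as [v0 [Tg [Lg [[v0' Vg] [Cg Pg]]]]].
  pose proof (piecewise_projective_increasing u0 Tf Cf Pf) as If.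
  pose proof (piecewise_projective_increasing v0 Tg Cg Pg) as Ig.
  assert (Hgen : forall h, gen2 f g h ->
            exists u, on_line h u /\ affine_at_ends u0 v0 u).
  { apply gen_on_line.
    - intros h [-> | ->]; [exists u0 | exists v0]; (split; [auto|]);
        (split; [auto|]); (split; [eauto|]); intros sg e Hs F1 F2;
        (split; [auto|]); eapply projective_affine_germ; eauto.
    - apply affine_at_ends_id.
    - apply affine_at_ends_comp.
    - apply affine_at_ends_inverse. }
  assert (Hlines : forall u, lines (gen2 f g) u -> affine_at_ends u0 v0 u).
  { intros u [h [Gh Lh]]. destruct (Hgen h Gh) as [v [Lv Av]].
    rewrite (on_line_unique h u v); auto. }
  assert (HG : increasing_group (lines (gen2 f g))).
  { split.
    - intros u Hu. apply Hlines; auto.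
    - exists (fun p => p). split; [apply gen_id | split; auto].
    - intros u v [h [Gh Lh]] [k [Gk Lk]]. exists (Defs.comp h k).
      split; [apply gen_comp; auto | apply on_line_comp; auto].
    - intros u Hu. pose proof (Hlines u Hu) as [_ [[u' Vu] _]].
      destruct Hu as [h [Gh Lh]].
      exists u'. split; auto.
      set (h' := fun p : P1 => match p with Some x => Some (u' x) | None => None end).
      exists h'. split; [|split; auto].
      destruct Vu as [V1 V2]. destruct Lh as [L1 L2].
      apply (gen_inv _ h h' Gh); intros [x|]; simpl;
        rewrite ?L1, ?L2; simpl; rewrite ?V1, ?V2; auto. }
  assert (Hder : forall h, derived (gen2 f g) h ->
            exists u, on_line h u /\ translation_at_ends u0 v0 u).
  { apply gen_on_line.
    - intros h Hh.
      assert (gen2 f g h) as Gh by (apply gen_commutators_sub; apply gen_base; auto).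
      destruct Hh as [k [k' [l [l' [Gk [Gl [I1 [I2 [I3 [I4 E]]]]]]]]]].
      destruct (Hgen h Gh) as [w [Lw Aw]].
      destruct (Hgen k Gk) as [u [Lu Au]].
      destruct (Hgen l Gl) as [v [Lv Av]].
      exists w. split; auto.
      apply (translation_at_ends_commutator u0 v0 u v w); auto.
      intros x.
      assert (l (k (h (Some x))) = k (l (Some x))) as K.
      { rewrite E, I2, I4. auto. }
      rewrite (proj2 Lw), (proj2 Lu), !(proj2 Lv), (proj2 Lu) in K. congruence.
    - apply translation_at_ends_id.
    - apply translation_at_ends_comp.
    - apply translation_at_ends_inverse. }
  destruct (classic (metabelian (gen2 f g))) as [M|M]; [left; auto|right].
  apply contains_Z2_of_lines.
  (* Two noncommuting elements of the derived group already disagree at a finite point, since all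
     maps fix infinity. *)
  assert (exists u v x, lines (gen2 f g) u /\ lines (gen2 f g) v /\
    translation_at_ends u0 v0 u /\ translation_at_ends u0 v0 v /\ u (v x) <> v (u x))
    as [u [v [x [Gu [Gv [Tu [Tv Ne]]]]]]].
  { apply NNPP. intro N. apply M. intros h k Dh Dk p.
    destruct (Hder h Dh) as [u [Lu Tu]]. destruct (Hder k Dk) as [v [Lv Tv]].
    destruct p as [x|].
    - rewrite (proj2 Lv), !(proj2 Lu), (proj2 Lv). f_equal.
      apply NNPP. intro Ne. apply N. exists u, v, x.
      split; [exists h; split; [apply gen_commutators_sub|]; auto|].
      split; [exists k; split; [apply gen_commutators_sub|]; auto|].
      auto.
    - rewrite (proj1 Lv), !(proj1 Lu), (proj1 Lv). auto. }
  destruct (ig_inv _ HG u Gu) as [u' [Gu' Vu]].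
  destruct (ig_inv _ HG v Gv) as [v' [Gv' Vv]].
  set (w := fun x => u' (v' (u (v x)))).
  assert (Gw : lines (gen2 f g) w).
  { apply (ig_comp _ HG u' (fun x => v' (u (v x)))); auto.
    apply (ig_comp _ HG v' (fun x => u (v x))); auto. apply HG; auto. }
  assert (Ew : forall x, v (u (w x)) = u (v x)).
  { intros z. unfold w. rewrite (proj2 Vu), (proj2 Vv). auto. }
  assert (Lu0 : lines (gen2 f g) u0) by (exists f; split; [apply gen_base|]; auto).
  assert (Lv0 : lines (gen2 f g) v0) by (exists g; split; [apply gen_base|]; auto).
  destruct (fixed_points_tame u0 Tf Pf) as [Tf' Hf'].
  destruct (fixed_points_tame v0 Tg Pg) as [Tg' Hg'].
  (* A point fixed by both generators is an end for [affine_at_ends], which records that the group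
     fixes it; the choice of side is immaterial. *)
  assert (Hcf : forall x, u0 x = x -> v0 x = x -> common_fixed (lines (gen2 f g)) x).
  { intros z E1 E2 s Hs.
    destruct (Hlines s Hs) as [_ [_ Q]].
    exact (proj1 (Q 1 (Some z) (or_introl eq_refl) E1 E2)). }
  destruct (finitely_many_components (common_fixed (lines (gen2 f g))) (Tf' ++ Tg'))
    as [L HL].
  { intros z y Szy Fz. apply Hcf.
    - apply (Hf' z); [|apply Fz; auto].
      eapply same_side_sub; [|exact Szy]. intros t Ht. apply in_or_app. auto.
    - apply (Hg' z); [|apply Fz; auto].
      eapply same_side_sub; [|exact Szy]. intros t Ht. apply in_or_app. auto. }
  (* As a commutator of two elements with translation germs, [w] is trivial near every end. *)
  apply (independent_pair_of_trivial_at_ends _ HG L w).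
  - split; auto. intros sg e Hs He.
    apply (translations_commute_near_end u0 v0 u v); auto.
  - exists x. intro E. apply Ne. rewrite <- Ew, E. auto.
  - intros z Hz. apply HL. intro F. apply Hz. auto.
Qed.
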